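(* Let $Z=\mathbb{R}^K\times\mathbb{R}$, let $\mathcal{P}$ be a statistical model on $Z^\infty$ equipped with an ATTS sequence of statistics $(S_n)$, and consider a smoothed conformal predictor (determined by some nonconformity measure). If the sequence of observations $(\mathbf{x}_n,y_n)$, $n=1,2,\ldots$, is generated by a probability distribution $P\in\mathcal{P}$ and the smoothed conformal predictor is fed with random numbers $(\tau_1,\tau_2,\ldots)\sim U^\infty$ independent of the observations, then for any significance level $\varepsilon\in(0,1)$ the error sequence $\mathrm{err}_1^\varepsilon,\mathrm{err}_2^\varepsilon,\ldots$ is a sequence of IID Bernoulli random variables with parameter $\varepsilon$.
   Context: The observation space is $Z=\mathbb{R}^K\times\mathbb{R}$, with observations $\zeta_n=(\mathbf{x}_n,y_n)$. A statistical model $\mathcal{P}$ on $Z^\infty$ is a family of probability distributions on $Z^\infty$. $U$ is the uniform distribution on $[0,1]$, and $U^\infty$ is the distribution of an infinite sequence of independent $U$-distributed random variables. Let $S_n: Z^n\to\Sigma_n$, $n=1,2,\ldots$, be statistics (measurable maps into measurable spaces) with $\Sigma_n=S_n(Z^n)$. The sequence $(S_n)$ is algebraically transitive if there are measurable functions $F_n:\Sigma_{n-1}\times Z\to\Sigma_n$, $n=2,3,\ldots$, such that $S_n(\zeta_1,\ldots,\zeta_n)=F_n(S_{n-1}(\zeta_1,\ldots,\zeta_{n-1}),\zeta_n)$ for all $(\zeta_1,\ldots,\zeta_n)\in Z^n$. It is totally sufficient for $\mathcal{P}$ if, for each $n=1,2,\ldots$: (i) $S_n$ is sufficient for $\mathcal{P}$;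 (ii) for any $P\in\mathcal{P}$, if $(\zeta_1,\zeta_2,\ldots)\sim P$, then $(\zeta_1,\ldots,\zeta_n)$ and $(\zeta_{n+1},\zeta_{n+2},\ldots)$ are conditionally independent given $S_n(\zeta_1,\ldots,\zeta_n)$. An ATTS sequence is a sequence of statistics that is both algebraically transitive and totally sufficient for $\mathcal{P}$. Let $\Sigma_0$ be a fixed one-element set ($S_0$ of the empty sequence is its element). A nonconformity measure is any sequence of measurable functions $A_n:\Sigma_{n-1}\times Z\to\mathbb{R}$, $n=1,2,\ldots$. Given a nonconformity measure, $\zeta_1,\zeta_2,\ldots\in Z$ and $\tau_1,\tau_2,\ldots\in[0,1]$, the p-values are $$p_n(\zeta_1,\ldots,\zeta_n,\tau_n):=\mathbb{P}(A_n^{\mathrm{rnd}}>A_n^{\mathrm{obs}}\mid S_n^{\mathrm{rnd}}=S_n^{\mathrm{obs}})+\tau_n\,\mathbb{P}(A_n^{\mathrm{rnd}}=A_n^{\mathrm{obs}}\mid S_n^{\mathrm{rnd}}=S_n^{\mathrm{obs}}),$$ where $A_n^{\mathrm{rnd}}:=A_n(S_{n-1}(\xi_1,\ldots,\xi_{n-1}),\xi_n)$, $S_n^{\mathrm{rnd}}:=S_n(\xi_1,\ldots,\xi_n)$, $A_n^{\mathrm{obs}}:=A_n(S_{n-1}(\zeta_1,\ldots,\zeta_{n-1}),\zeta_n)$, $S_n^{\mathrm{obs}}:=S_n(\zeta_1,\ldots,\zeta_n)$; here the $\zeta_i$ are treated as fixed, and the probabilities are over $(\xi_1,\xi_2,\ldots)\sim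 P$ for some $P\in\mathcal{P}$. Since $S_n$ is sufficient, the regular conditional probabilities are chosen so that $p_n$ does not depend on $P\in\mathcal{P}$. The smoothed conformal predictor determined by $(A_n)$ outputs, for each $\varepsilon\in(0,1)$ and $n$, the prediction region $$\Gamma_n^\varepsilon=\Gamma^\varepsilon(\mathbf{x}_1,y_1,\ldots,\mathbf{x}_{n-1},y_{n-1},\mathbf{x}_n,\tau_n):=\{y\in\mathbb{R}: p_n((\mathbf{x}_1,y_1),\ldots,(\mathbf{x}_{n-1},y_{n-1}),(\mathbf{x}_n,y),\tau_n)>\varepsilon\}.$$ Its error at step $n$ at significance level $\varepsilon$ is $\mathrm{err}_n^\varepsilon:=1$ if $y_n\notin\Gamma_n^\varepsilon$ and $\mathrm{err}_n^\varepsilon:=0$ otherwise. *)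

(* Defs.v *)
From HB Require Import structures.
From mathcomp Require Import all_boot all_order all_algebra finmap.
From mathcomp Require Import all_classical all_reals all_analysis measurable_realfun.
Set Implicit Arguments.
Unset Strict Implicit.
Unset Printing Implicit Defensive.
Import Order.TTheory GRing.Theory Num.Theory.
Import numFieldNormedType.Exports.
Local Open Scope classical_set_scope.
Local Open Scope ring_scope.

(* [nat -> T] with the product sigma-algebra, generated by the coordinate maps. *)
Definition cylinders d (T : measurableType d) : set (set (nat -> T)) :=
  \bigcup_(i in [set: nat])
    preimage_set_system setT (fun z : nat -> T => z i) measurable.
Arguments cylinders {d} T.

Notation seqspace T := (g_sigma_algebraType (cylinders T)).

(* R^K carries the product sigma-algebra of [K.-tuple R], that is, the Borel
   sets of R^K. *)
Notation obs R K := (K.-tuple (R : realType) * (R : realType))%type.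

Section tuples.
Context {T : Type}.

Definition tinit n (z : n.+1.-tuple T) : n.-tuple T :=
  [tuple tnth z (widen_ord (leqnSn n) i) | i < n].

Definition tlast n (z : n.+1.-tuple T) : T := tnth z ord_max.

Definition first_obs n (z : nat -> T) : n.-tuple T := [tuple z i | i < n].

Definition later_obs n (z : nat -> T) : nat -> T := fun i => z (n + i)%N.

End tuples.

Section independence.
Context d (Om : measurableType d) (R : realType) (P : probability Om R).
Local Open Scope ereal_scope.

Definition independent_pair d1 d2 (T1 : measurableType d1)
    (T2 : measurableType d2) (X : Om -> T1) (Y : Om -> T2) : Prop :=
  forall A B, measurable A -> measurable B ->
    P (X @^-1` A `&` Y @^-1` B) = P (X @^-1` A) * P (Y @^-1` B).

Definition mutually_independent d1 (T : measurableType d1)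
    (X : nat -> Om -> T) : Prop :=
  forall (J : {fset nat}) (B : nat -> set T),
    (forall i, i \in J -> measurable (B i)) ->
    P (\bigcap_(i in [set` J]) (X i @^-1` B i)) =
    \prod_(i <- J) P (X i @^-1` B i).

Definition iid d1 (T : measurableType d1) (X : nat -> Om -> T)
    (mu : set T -> \bar R) : Prop :=
  [/\ forall n, measurable_fun setT (X n),
      mutually_independent X &
      forall n B, measurable B -> P (X n @^-1` B) = mu B].

(* [f] is a version of the conditional probability u |-> P (E | W = u). *)
Definition is_cprob d1 (U : measurableType d1) (W : Om -> U) (E : set Om)
    (f : U -> \bar R) : Prop :=
  [/\ measurable_fun setT f,
      P.-integrable setT (f \o W) &
      forall C, measurable C ->
        \int[P]_(w in W @^-1` C) f (W w) = P (E `&` W @^-1` C)].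

(* Since versions are almost surely unique, it does not matter which versions
   of P (X \in A | W) and P (Y \in B | W) are multiplied. *)
Definition cond_independent d1 d2 d3 (T1 : measurableType d1)
    (T2 : measurableType d2) (U : measurableType d3)
    (X : Om -> T1) (Y : Om -> T2) (W : Om -> U) : Prop :=
  forall A B, measurable A -> measurable B ->
    exists f g : U -> \bar R,
      [/\ is_cprob W (X @^-1` A) f, is_cprob W (Y @^-1` B) g &
          is_cprob W (X @^-1` A `&` Y @^-1` B) (fun u => f u * g u)].

(* [Q] is a regular conditional distribution of [X] given [W]. *)
Definition is_rcd d1 d2 (T : measurableType d1) (U : measurableType d2)
    (X : Om -> T) (W : Om -> U) (Q : R.-pker U ~> T) : Prop :=
  forall A, measurable A -> is_cprob W (X @^-1` A) (fun u => Q u A).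

End independence.

Section statistics.
Context (R : realType) dZ (Z : measurableType dZ).
Context (dS : nat -> measure_display) (Sigma : forall n, measurableType (dS n)).
Variable S : forall n, {mfun n.-tuple Z >-> Sigma n}.

(* For n = 0 this forces [Sigma 0] to be a one-element set. *)
Definition onto_statistics : Prop := forall n, range (S n) = setT.

Definition algebraically_transitive : Prop :=
  forall n, (0 < n)%N -> exists F : {mfun (Sigma n * Z)%type >-> Sigma n.+1},
    forall z : n.+1.-tuple Z, S n.+1 z = F (S n (tinit z), tlast z).

Variable model : set (probability (seqspace Z) R).

Definition common_rcd n (Q : R.-pker (Sigma n) ~> (n.-tuple Z)) : Prop :=
  forall P, model P ->
    is_rcd P (fun z : seqspace Z => first_obs n z)
             (fun z : seqspace Z => S n (first_obs n z)) Q.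

Definition sufficient n : Prop :=
  exists Q : R.-pker (Sigma n) ~> (n.-tuple Z), common_rcd Q.

Definition totally_sufficient : Prop :=
  forall n, (0 < n)%N ->
    sufficient n /\
    (forall P, model P ->
       cond_independent P
         (fun z : seqspace Z => first_obs n z)
         (fun z : seqspace Z => later_obs n z : seqspace Z)
         (fun z : seqspace Z => S n (first_obs n z))).

Definition ATTS : Prop :=
  [/\ onto_statistics, algebraically_transitive & totally_sufficient].

(* [A n] is the nonconformity measure used at step n+1. *)
Variable A : forall n, {mfun (Sigma n * Z)%type >-> R}.

Definition score n (z : n.+1.-tuple Z) : R := A n (S n (tinit z), tlast z).

(* [Q n s] is the chosen conditional distribution of the first n observations
   given that the value of the statistic [S n] is s. *)
Variable Q : forall n, R.-pker (Sigma n) ~> (n.-tuple Z).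

Definition pvalue n (z : n.+1.-tuple Z) (tau : R) : R :=
  fine (Q n.+1 (S n.+1 z) [set xi | score xi > score z]) +
  tau * fine (Q n.+1 (S n.+1 z) [set xi | score xi = score z]).

End statistics.

Section conformal_predictor.
Context (R : realType) (K : nat).
Context (dS : nat -> measure_display) (Sigma : forall n, measurableType (dS n)).
Variable S : forall n, {mfun n.-tuple (obs R K) >-> Sigma n}.
Variable A : forall n, {mfun (Sigma n * obs R K)%type >-> R}.
Variable Q : forall n, R.-pker (Sigma n) ~> (n.-tuple (obs R K)).

Definition prediction_region (eps : R) n (past : n.-tuple (obs R K))
    (x : K.-tuple R) (tau : R) : set R :=
  [set y | pvalue S A Q [tuple of rcons past (x, y)] tau > eps].

(* Sequences are indexed from 0: [err eps z tau n] is the error at step n+1,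
   with [true] standing for 1 and [false] for 0. *)
Definition err (eps : R) (z : nat -> obs R K) (tau : nat -> R) (n : nat) :
    bool :=
  ~~ `[< prediction_region eps (first_obs n z) (z n).1 (tau n) (z n).2 >].

End conformal_predictor.

(* Main.v *)
Require Import Defs.
From HB Require Import structures.
From mathcomp Require Import all_boot all_order all_algebra finmap.
From mathcomp Require Import all_classical all_reals all_analysis measurable_realfun.
Set Implicit Arguments.
Unset Strict Implicit.
Unset Printing Implicit Defensive.
Import Order.TTheory GRing.Theory Num.Theory.
Import numFieldNormedType.Exports.
Local Open Scope classical_set_scope.
Local Open Scope ring_scope.

(** The errors are independent because each of them is independent of the whole
    future, and all later errors belong to that future.

    Fix a step [n+1] and condition on the value [s] of the statistic
    [S n.+1]. By sufficiency the first [n+1] observations then have the known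
    distribution [Q n.+1 s], so the observed score is a draw from the image [k s] of
    that distribution under the score. The p-value is the upper tail of [k s] at
    the score, with the atom at the score weighted by an independent uniform
    number; by the randomized probability integral transform
    ([smoothed_tail_uniform]) it is at most [eps] with probability exactly
    [eps], whatever [s] is. Hence, given [S n.+1], an error has conditional
    probability [eps] ([smoothed_rank_uniform]).

    Total sufficiency strengthens this: given [S n.+1], the first [n+1]
    observations are independent of the later ones ([cond_independent_rcd]), and
    the random numbers used later are independent of everything used so far
    ([mutually_independent_tail]). So the error at step [n+1] is independent of
    the triple made of [S n.+1], the later observations and the later random
    numbers, called the future below ([miss_independent_of_future]).

    Algebraic transitivity makes the future decreasing: the future at time
    [n+1] is a function of the future at time [n], and so is the error at step
    [n+1] ([future_eventS], [future_event_miss]). The probability that the errors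
    of steps [n+1], ..., [n+N] fall into prescribed sets therefore factors by
    splitting off the earliest error, and induction on [N] gives the product
    formula.

    The independence statements are equalities of finite measures on product
    spaces, so it is enough to check them on rectangles and finite cylinders. *)

(** * Measures on product spaces *)

Section image_measure.
Context d1 d2 (T1 : measurableType d1) (T2 : measurableType d2) (R : realType).
Variables (m : {finite_measure set T1 -> \bar R}) (f : {mfun T1 >-> T2}).
Local Open Scope ereal_scope.

Definition image_measure : set T2 -> \bar R := pushforward m f.

Let image0 : image_measure set0 = 0.
Proof. exact: measure0. Qed.

Let image_ge0 A : 0 <= image_measure A.
Proof. exact: measure_ge0. Qed.

Let image_sigma_additive : semi_sigma_additive image_measure.
Proof. exact: measure_semi_sigma_additive. Qed.

HB.instance Definition _ := isMeasure.Build _ _ _ image_measure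
  image0 image_ge0 image_sigma_additive.

Let image_fin : fin_num_fun image_measure.
Proof.
move=> A mA; rewrite fin_num_measure//.
by rewrite -[X in measurable X]setTI; exact: measurable_funP.
Qed.

HB.instance Definition _ := Measure_isFinite.Build _ _ _ image_measure image_fin.

Lemma ge0_integral_image D (g : T2 -> \bar R) : measurable D ->
  measurable_fun D g -> (forall y, D y -> 0 <= g y) ->
  \int[image_measure]_(y in D) g y = \int[m]_(x in f @^-1` D) g (f x).
Proof.
move=> mD mg g0; apply: ge0_integral_pushforward => //.
by move=> y; rewrite inE; exact: g0.
Qed.

End image_measure.

Section product_uniqueness.
Context d1 d2 (T1 : measurableType d1) (T2 : measurableType d2) (R : realType).
Local Open Scope ereal_scope.

Lemma eq_measure_prod (m1 m2 : {measure set (T1 * T2) -> \bar R}) :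
  m1 setT < +oo ->
  (forall A B, measurable A -> measurable B -> m1 (A `*` B) = m2 (A `*` B)) ->
  forall E, measurable E -> m1 E = m2 E.
Proof.
move=> m1T m12 E mE.
apply: (measure_unique [set A `*` B | A in measurable & B in measurable]
  (fun=> setT)) => //.
- exact: measurable_prod_measurableType.
- move=> _ _ [A1 mA1 [B1 mB1 <-]] [A2 mA2 [B2 mB2 <-]].
  exists (A1 `&` A2); first exact: measurableI.
  by exists (B1 `&` B2); [exact: measurableI | rewrite setXI].
- by move=> _; exists setT => //; exists setT => //; rewrite setXTT.
- by rewrite bigcup_const//; exists 0%N.
- by move=> _ [A mA [B mB <-]]; exact: m12.
Qed.

End product_uniqueness.

Section semidirect_product.
Context d1 d2 (T1 : measurableType d1) (T2 : measurableType d2) (R : realType).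
Local Open Scope ereal_scope.
Variables (m : {finite_measure set T1 -> \bar R}) (k : R.-pker T1 ~> T2).

(** The law of a pair whose first component has law [m] and whose second
    component has conditional law [k x] given that the first is [x]. *)
Definition semidirect (E : set (T1 * T2)) : \bar R :=
  \int[m]_x k x (xsection E x).

Lemma measurable_kernel_xsection (E : set (T1 * T2)) : measurable E ->
  measurable_fun setT (fun x => k x (xsection E x)).
Proof. by move=> mE; apply: measurable_fun_xsection_finite_kernel; rewrite inE. Qed.

Let semidirect0 : semidirect set0 = 0.
Proof. by rewrite /semidirect integral0_eq// => x _; rewrite xsection0. Qed.

Let semidirect_ge0 E : 0 <= semidirect E.
Proof. exact: integral_ge0. Qed.

Let semidirect_sigma_additive : semi_sigma_additive semidirect.
Proof.
move=> F mF tF mUF.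
rewrite [X in _ --> X](_ : _ = \sum_(n <oo) semidirect (F n)).
  by apply/cvg_closeP; split; [exact: is_cvg_nneseries|rewrite closeE].
rewrite -integral_nneseries//; last by move=> n; exact: measurable_kernel_xsection.
apply: eq_integral => x _; apply/esym/cvg_lim => //=; rewrite xsection_bigcup.
apply: (measure_sigma_additive _ (trivIset_xsection tF)) => ?.
exact: measurable_xsection.
Qed.

HB.instance Definition _ := isMeasure.Build _ _ _ semidirect
  semidirect0 semidirect_ge0 semidirect_sigma_additive.

Lemma semidirectX A B : measurable A -> measurable B ->
  semidirect (A `*` B) = \int[m]_(x in A) k x B.
Proof.
move=> mA mB; rewrite /semidirect [RHS]integral_mkcond.
apply: eq_integral => x _; rewrite patchE; case: ifPn => xA.
  by rewrite in_xsectionX.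
by rewrite notin_xsectionX// measure0.
Qed.

Let semidirect_setT : semidirect setT = m setT.
Proof.
rewrite -setXTT semidirectX//.
under eq_integral do rewrite prob_kernel.
by rewrite integral_cst// mul1e.
Qed.

Let semidirect_fin : fin_num_fun semidirect.
Proof.
have : semidirect setT < +oo.
  by rewrite semidirect_setT ltey_eq fin_num_measure.
exact: lty_fin_num_fun.
Qed.

HB.instance Definition _ := Measure_isFinite.Build _ _ _ semidirect semidirect_fin.

End semidirect_product.

Section three_fold_uniqueness.
Context d1 d2 d3 (T1 : measurableType d1) (T2 : measurableType d2)
  (T3 : measurableType d3) (R : realType).
Local Open Scope ereal_scope.

(** The two-fold statement is applied twice: with the third side [C] fixed, both
    sides are finite measures in the product of the first two spaces. *)
Lemma eq_measure_prod3 (m1 m2 : {finite_measure set ((T1 * T2) * T3)%type -> \bar R}) :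
  (forall A B C, measurable A -> measurable B -> measurable C ->
    m1 ((A `*` B) `*` C) = m2 ((A `*` B) `*` C)) ->
  forall E, measurable E -> m1 E = m2 E.
Proof.
move=> m12; apply: eq_measure_prod; first by rewrite ltey_eq fin_num_measure.
move=> E C mE mC.
have mTC : measurable ([set: (T1 * T2)%type] `*` C) by exact: measurableX.
pose fI := isMeasurableFun.Build _ _ (T1 * T2 * T3)%type (T1 * T2)%type
  fst measurable_fst.
pose f : {mfun (T1 * T2 * T3)%type >-> (T1 * T2)%type} := HB.pack fst fI.
have imE (m : set ((T1 * T2) * T3)%type -> \bar R) X :
    pushforward (mrestr m mTC) f X = m (X `*` C).
  rewrite /pushforward /mrestr; congr (m _).
  by apply/seteqP; split => x /= [] // ? [].
transitivity (image_measure (mrestr m1 mTC) f E); first exact/esym/imE.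
transitivity (image_measure (mrestr m2 mTC) f E); last exact: imE.
apply: eq_measure_prod => //; first by rewrite ltey_eq fin_num_measure.
move=> A B mA mB; transitivity (m1 ((A `*` B) `*` C)); first exact: imE.
by rewrite m12//; exact/esym/imE.
Qed.

End three_fold_uniqueness.

(** * The randomized probability integral transform *)

Section unit_interval_law.
Variable R : realType.

Let idR : measurableTypeR R -> R := idfun.

#[local] HB.instance Definition _ :=
  @isMeasurableFun.Build _ _ _ _ idR (@measurable_id _ _ setT).

(** [uniform_prob] is a measure on a copy of [R]; its image under the identity is
    a measure on [R] itself. *)
Definition unit_uniform : probability R R :=
  distribution (uniform_prob (@ltr01 R)) (idR : {mfun _ >-> _}).

Lemma ge0_integral_unit_uniform (f : R -> \bar R) :
  measurable_fun setT f -> (forall x, (0 <= f x)%E) ->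
  (\int[unit_uniform]_x f x =
   \int[lebesgue_measure]_(x in `[0%R, 1%R] : set (measurableTypeR R)) f x)%E.
Proof.
move=> mf f0; rewrite ge0_integral_distribution// integral_uniform//.
by rewrite subr0 invr1 mul1e.
Qed.

End unit_interval_law.

(** The p-value of the value [a] of a test statistic with law [mu], with ties
    broken by [t]. *)
Definition smoothed_tail (R : realType) (mu : set R -> \bar R) (a t : R) : R :=
  fine (mu [set b | b > a]) + t * fine (mu [set b | b = a]).

Section probability_integral_transform.
Context (R : realType).
Variable mu : probability R R.

Let mid := isMeasurableFun.Build _ _ R R (@idfun R) (@measurable_id _ R setT).
Let X : {RV mu >-> R} := HB.pack (@idfun R) mid.

Let tailE a : mu [set b | b > a] = ccdf X a.
Proof.
rewrite /ccdf /distribution/= /pushforward; congr (mu _).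
by apply/seteqP; split => b /=; rewrite in_itv/= andbT.
Qed.

Let upsetE a : `]a, +oo[%classic = [set b : R | b > a].
Proof. by apply/seteqP; split => b /=; rewrite in_itv/= andbT. Qed.

Let mray a : measurable [set b : R | b > a].
Proof. by rewrite -upsetE. Qed.

Let measurable_upper_tail :
  measurable_fun setT (fun a : R => fine (mu [set b : R | b > a])).
Proof.
apply: measurableT_comp => //.
rewrite (_ : (fun _ => _) = ccdf X); first exact: ccdf_measurable.
by apply/funext => a; rewrite tailE.
Qed.

Variable eps : R.
Hypotheses (eps_gt0 : 0 < eps) (eps_lt1 : eps < 1).

(** The witness is the infimum of the points whose strict upper tail has mass at
    most [eps]. The infimum is attained because strict upper tails are right
    continuous, and the closed tail at it is a decreasing limit of tails of mass
    above [eps]. *)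
Lemma upper_quantile : exists q : R,
  [/\ forall a, q < a -> (mu [set b | (b >= a)%R] <= eps%:E)%E,
      forall a, a < q -> (eps%:E < mu [set b | (b > a)%R])%E,
      (mu [set b | (b > q)%R] <= eps%:E)%E & (eps%:E <= mu [set b | (b >= q)%R])%E].
Proof.
pose E := [set a : R | (mu [set b | (b > a)%R] <= eps%:E)%E].
have E0 : E !=set0.
  have [|M [Mr HM]] := @cvg_ccdfy0 _ _ _ _ X [set x | (x < eps%:E)%E].
    by apply: open_nbhs_nbhs; split; [exact: open_ereal_lt_ereal|rewrite /= lte_fin].
  exists (M + 1); rewrite /E/= tailE ltW//.
  by apply: HM; rewrite ltrDl.
have [a0 a0E] : exists a0, (eps%:E < mu [set b | (b > a0)%R])%E.
  have [|M [Mr HM]] := @cvg_ccdfNy1 _ _ _ _ X [set x | (eps%:E < x)%E].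
    by apply: open_nbhs_nbhs; split; [exact: open_ereal_gt_ereal|rewrite /= lte_fin].
  exists (M - 1); rewrite tailE.
  by apply: HM; rewrite gtrBl.
have lbE : lbound E a0.
  move=> a Ea; rewrite leNgt; apply/negP => aa0.
  have : (mu [set b | (b > a0)%R] <= eps%:E)%E; last by rewrite leNgt a0E.
  apply: le_trans Ea; apply: le_measure; rewrite ?inE//.
  by move=> b /=; exact: lt_trans.
have hlb : has_lbound E by exists a0.
pose q := inf E; exists q.
have below a : a < q -> (eps%:E < mu [set b | (b > a)%R])%E.
  move=> aq; rewrite ltNge; apply/negP => Ea.
  by have := ge_inf hlb Ea; rewrite leNgt aq.
have above a : q < a -> (mu [set b | (b > a)%R] <= eps%:E)%E.
  move=> /(inf_lt E0)[b Eb ba]; apply: le_trans Eb.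
  apply: le_measure; rewrite ?inE//.
  by move=> c /=; exact: lt_trans.
have mcray a : measurable [set b : R | b >= a].
  rewrite (_ : [set _ | _] = `[a, +oo[%classic)//.
  by apply/seteqP; split => b /=; rewrite in_itv/= andbT.
split => //.
- move=> a qa; have qm : q < (q + a) / 2 by rewrite midf_lt.
  apply: le_trans (above _ qm).
  apply: le_measure; rewrite ?inE//.
  by move=> b /=; apply: lt_le_trans; rewrite midf_lt.
- rewrite tailE; apply: (@cvge_to_le _ (q^'+) _ _ (ccdf X)).
    exact: ccdf_right_continuous.
  near=> a; rewrite -tailE; apply: above; near: a; exact: nbhs_right_gt.
- rewrite (_ : [set b | b >= q] = `[q, +oo[%classic); last first.
    by apply/seteqP; split => b /=; rewrite in_itv/= andbT.
  rewrite itvcyEbigcap.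
  set F := fun k : nat => `]q - k.+1%:R^-1, +oo[%classic.
  have mF k : measurable (F k) by exact: measurable_itv.
  have : (mu \o F) n @[n --> \oo] --> mu (\bigcap_n F n).
    apply: nonincreasing_cvg_mu => //.
    - by rewrite ltey_eq fin_num_measure.
    - exact: bigcapT_measurable.
    - move=> m n mn; apply/subsetPset; rewrite /F !upsetE => b /=.
      apply: le_lt_trans; rewrite lerD2l lerN2 lef_pV2 ?posrE// ler_nat.
      by rewrite ltnS.
  move=> /cvge_to_ge; apply; near=> n; rewrite /F/= upsetE ltW//.
  by apply: below; rewrite gtrBl.
Unshelve. all: by end_near. Qed.

(** Let [q] be the upper quantile, [g] the mass above [q] and [p] the mass of
    [q]. For [t] in [[0, 1]] the values with smoothed tail at most [eps] are
    those above [q], together with [q] itself exactly when [g + t * p <= eps].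
    Integrating over [t] gives [g + p * ((eps - g) / p) = eps]; the cut-off
    [(eps - g) / p] lies in [[0, 1]] by the choice of [q]. *)
Lemma smoothed_tail_uniform :
  (\int[unit_uniform R]_t mu [set a | (smoothed_tail mu a t <= eps)%R]
   = eps%:E)%E.
Proof.
have [q [above below qle qge]] := upper_quantile.
have fmu A : measurable A -> (fine (mu A))%:E = mu A.
  by move=> mA; rewrite fineK// fin_num_measure.
have mcray a : measurable [set b : R | b >= a].
  rewrite (_ : [set _ | _] = `[a, +oo[%classic)//.
  by apply/seteqP; split => b /=; rewrite in_itv/= andbT.
have matom a : measurable [set b : R | b = a] by exact: measurable_set1.
pose g := fine (mu [set b | b > q]); pose p := fine (mu [set b | b = q]).
have crayE a : mu [set b | b >= a] =
    (fine (mu [set b | (b > a)%R]) + fine (mu [set b | b = a]))%:E.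
  rewrite EFinD !fmu// -measureU//; last first.
    by apply/seteqP; split => // b [/= + ba]; rewrite ba ltxx.
  congr (mu _); apply/seteqP; split => b /=.
    by rewrite le_eqVlt => /predU1P[->|]; [right|left].
  by case=> [/ltW//|->].
have gle : g <= eps by rewrite -lee_fin fmu.
have gpge : eps <= g + p by rewrite -lee_fin -crayE.
have p_ge0 : 0 <= p by rewrite fine_ge0.
have g_ge0 : 0 <= g by rewrite fine_ge0.
have setE t : t \in `[0, 1] -> mu [set a | smoothed_tail mu a t <= eps] =
    (g%:E + (p * \1_[set s | g + s * p <= eps] t)%:E)%E.
  rewrite in_itv/= => /andP[t0 t1].
  have [gtp|gtp] := leP (g + t * p) eps.
    rewrite indicE mem_set// mulr1 -EFinD -crayE; congr (mu _).
    apply/seteqP; split => a /=.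
      rewrite leNgt => H; rewrite leNgt; apply: contra H => /below aq.
      rewrite /smoothed_tail -lte_fin (lt_le_trans aq)//.
      by rewrite EFinD fmu// leeDl// lee_fin mulr_ge0// fine_ge0.
    rewrite le_eqVlt => /predU1P[<-//|/above]; rewrite crayE lee_fin.
    by apply: le_trans; rewrite lerD2l ler_piMl// fine_ge0.
  rewrite indicE memNset/= ?mulr0 ?adde0; last by apply/negP; rewrite -ltNge.
  rewrite /g fmu//; congr (mu _).
  apply/seteqP; split => a /=.
    move=> H; rewrite ltNge; apply/negP; rewrite le_eqVlt => /predU1P[aq|/below aq].
      by move: H; rewrite aq leNgt gtp.
    move: H; rewrite leNgt => /negP; apply.
    rewrite /smoothed_tail -lte_fin (lt_le_trans aq)//.
    by rewrite EFinD fmu// leeDl// lee_fin mulr_ge0// fine_ge0.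
  move=> /above; rewrite crayE lee_fin.
  by apply: le_trans; rewrite lerD2l ler_piMl// fine_ge0.
rewrite ge0_integral_unit_uniform//; last first.
  have mH : measurable [set ta : R * R | smoothed_tail mu ta.2 ta.1 <= eps].
    rewrite -[X in measurable X]setTI.
    apply: measurable_fun_le => //.
    apply: measurable_funD.
      exact: (measurableT_comp measurable_upper_tail measurable_snd).
    apply: measurable_funM => //.
    exact: (measurableT_comp (@pmf_measurable _ _ _ mu X) measurable_snd).
  rewrite [X in measurable_fun _ X](_ : _ = fun t =>
      mu (xsection [set ta : R * R | smoothed_tail mu ta.2 ta.1 <= eps] t)).
    exact: measurable_fun_xsection.
  by apply/funext => t; rewrite xsectionE.
transitivity (\int[lebesgue_measure]_(t in `[0%R, 1%R])
    (g%:E + (p * \1_[set s | g + s * p <= eps] t)%:E))%E.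
  by apply: eq_integral => t; rewrite inE => t01; exact: setE.
have mc : measurable [set s : R | g + s * p <= eps].
  rewrite -[X in measurable X]setTI.
  apply: measurable_fun_le => //.
  by apply: measurable_funD => //; apply: measurable_funM.
rewrite ge0_integralD//=; last 2 first.
- by move=> t _; rewrite lee_fin mulr_ge0.
- by apply/measurable_EFinP/measurable_funTS; apply: measurable_funM.
under [X in (_ + X)%E]eq_integral do rewrite EFinM.
rewrite integral_cst// ge0_integralZl//=; last first.
  by apply/measurable_EFinP/measurable_funTS.
rewrite integral_indic//= lebesgue_measure_itv/= lte_fin ltr01 sube0 mule1.
(* Without an atom at [q] the two quantile inequalities force [g = eps]. *)
have [p0|pN0] := eqVneq p 0.
  rewrite p0 mul0e adde0; congr (_%:E); apply/eqP; rewrite eq_le gle.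
  by move: gpge; rewrite p0 addr0.
have p_gt0 : 0 < p by rewrite lt_neqAle eq_sym pN0.
have -> : [set s | g + s * p <= eps] `&` `[0, 1]%classic =
    `[0, (eps - g) / p]%classic.
  apply/seteqP; split => s /=; rewrite !in_itv/=.
    by case=> H /andP[-> _]/=; rewrite ler_pdivlMr// lerBrDl.
  move=> /andP[-> H]; split; first by rewrite -lerBrDl -ler_pdivlMr.
  by rewrite (le_trans H)// ler_pdivrMr// mul1r lerBlDl.
rewrite lebesgue_measure_itv/= lte_fin.
have [c_gt0|] := ltP 0 ((eps - g) / p).
  by rewrite sube0 -EFinM -EFinD mulrC divfK// addrC subrK.
rewrite ler_pdivrMr// mul0r subr_le0 mule0 adde0 => eg.
by congr (_%:E); apply/eqP; rewrite eq_le gle.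
Qed.
End probability_integral_transform.

(** * P-values computed from a conditional law *)

Section kernel_value.
Context d1 d2 (U : measurableType d1) (T : measurableType d2) (R : realType).
Variables (k : R.-pker U ~> T) (u : U).

(** [k u] as a probability rather than a mere measure. *)
Definition kernel_value : set T -> \bar R := k u.

HB.instance Definition _ := Measure.on kernel_value.
HB.instance Definition _ := Measure_isProbability.Build _ _ _ kernel_value
  (@prob_kernel _ _ _ _ _ k u).

End kernel_value.

Section smoothed_rank.
Context d1 (U : measurableType d1) (R : realType) (k : R.-pker U ~> R).

(** [k] is viewed as a kernel from [U * T] that does not look at its second
    argument, so that the set it measures may depend on that argument. *)
Lemma measurable_kernel_family_xsection d2 (T : measurableType d2)
    (E : set ((U * T) * R)) :
  measurable E -> measurable_fun setT (fun x => k x.1 (xsection E x)).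
Proof.
move=> mE.
pose k' (x : U * T) : {measure set R -> \bar R} := k x.1.
have mk' V : measurable V -> measurable_fun setT (k' ^~ V).
  move=> mV; exact: (measurableT_comp (measurable_kernel k V mV) measurable_fst).
pose K := isKernel.Build _ _ _ _ _ k' mk'.
have uk' : measure_fam_uub k'.
  by exists 2 => x; rewrite /k' prob_kernel lte_fin ltr1n.
pose k1 : R.-ker (U * T)%type ~> R := HB.pack k' K.
pose K2 := Kernel_isFinite.Build _ _ _ _ _ k1 uk'.
pose k2 : R.-fker (U * T)%type ~> R := HB.pack k' K K2.
by apply: (measurable_fun_xsection_finite_kernel k2); rewrite inE.
Qed.

Lemma measurable_smoothed_tail : measurable_fun setT
  (fun x : R * (U * R) => smoothed_tail (k x.2.1) x.2.2 x.1).
Proof.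
pose above := [set x : (U * R) * R | x.1.2 < x.2].
pose atom := [set x : (U * R) * R | x.2 = x.1.2].
have m12 : measurable_fun setT (fun x : (U * R) * R => x.1.2).
  exact: (measurableT_comp measurable_snd measurable_fst).
have mabove : measurable above.
  rewrite -[X in measurable X]setTI.
  have /(_ measurableT [set true]) := measurable_fun_ltr m12 measurable_snd.
  exact.
have matom : measurable atom.
  rewrite (_ : atom = [set x | x.2 == x.1.2]); last first.
    by apply/seteqP; split => x /= /eqP.
  rewrite -[X in measurable X]setTI.
  have /(_ measurableT [set true]) := measurable_fun_eqr measurable_snd m12.
  exact.
have mfk E : measurable E -> measurable_fun setT
    (fun x : R * (U * R) => fine (k x.2.1 (xsection E x.2))).
  move=> mE; apply: measurableT_comp => //.
  exact: (measurableT_comp (measurable_kernel_family_xsection mE) measurable_snd).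
rewrite (_ : (fun _ => _) = (fun x : R * (U * R) =>
    fine (k x.2.1 (xsection above x.2)) +
    x.1 * fine (k x.2.1 (xsection atom x.2)))).
  by apply: measurable_funD; [exact: mfk|apply: measurable_funM => //; exact: mfk].
by apply/funext => x; rewrite !xsectionE.
Qed.

End smoothed_rank.

Section conditional_rank.
Context d (Om : measurableType d) d1 (U : measurableType d1) (R : realType).
Variables (m : {finite_measure set Om -> \bar R}) (k : R.-pker U ~> R).
Variables (W : {mfun Om >-> U}) (a t : {mfun Om >-> R}).
Let unif : probability R R := unit_uniform R.
Hypothesis joint : forall C A F, measurable C -> measurable A -> measurable F ->
  m (t @^-1` F `&` (W @^-1` C `&` a @^-1` A)) =
  (unif F * \int[m]_(w in W @^-1` C) k (W w) A)%E.
Variables (eps : R) (eps_gt0 : 0 < eps) (eps_lt1 : eps < 1).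

Let mWa : measurable_fun setT (fun w => (W w, a w)).
Proof. exact: measurable_fun_pair. Qed.

Let mtWa : measurable_fun setT (fun w => (t w, (W w, a w))).
Proof. exact: measurable_fun_pair. Qed.

Let mWaI := isMeasurableFun.Build _ _ _ _ _ mWa.
Let Wa : {mfun Om >-> (U * R)%type} := HB.pack (fun w => (W w, a w)) mWaI.
Let mtWaI := isMeasurableFun.Build _ _ _ _ _ mtWa.
Let tWa : {mfun Om >-> (R * (U * R))%type} :=
  HB.pack (fun w => (t w, (W w, a w))) mtWaI.

Let nu := semidirect (image_measure m W) k.

(** [joint] extended from rectangles to all events about the pair [(W, a)]. *)
Let law_Wa F E : measurable F -> measurable E ->
  m (t @^-1` F `&` Wa @^-1` E) = (unif F * nu E)%E.
Proof.
move=> mF mE.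
have mtF : measurable (t @^-1` F).
  by rewrite -[X in measurable X]setTI; exact: measurable_funP.
have uF : 0 <= fine (unif F) by rewrite fine_ge0.
transitivity (mscale (NngNum uF) nu E); last first.
  by rewrite /mscale/= fineK// fin_num_measure.
rewrite setIC.
apply: (eq_measure_prod (m1 := image_measure (mrestr m mtF) Wa)) => //.
  by rewrite ltey_eq fin_num_measure.
move=> C A mC mA; rewrite /image_measure /pushforward/= /mrestr/= /mscale/=.
rewrite fineK ?fin_num_measure// /nu semidirectX//.
rewrite ge0_integral_image//.
  by rewrite setIC -joint.
exact/measurable_funTS/measurable_kernel.
Qed.

(** [joint] says that, under [m], [a] has conditional law [k (W w)] given [W] and
    [t] is uniform and independent of [(W, a)]. Fubini's theorem moves the
    integral over [t] inside the one over [W], where it is the probability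
    integral transform for the law [k u]. In the application [m] is a probability
    restricted to an event of the future, which is how that event gets
    conditioned on. *)
Lemma smoothed_rank_uniform C : measurable C ->
  m ([set w | smoothed_tail (k (W w)) (a w) (t w) <= eps] `&` W @^-1` C) =
  (eps%:E * m (W @^-1` C))%E.
Proof.
move=> mC.
pose G := [set x : R * (U * R) | smoothed_tail (k x.2.1) x.2.2 x.1 <= eps] `&`
  [set x | C x.2.1].
have mG : measurable G.
  apply: measurableI.
    rewrite -[X in measurable X]setTI.
    by apply: measurable_fun_le => //; exact: measurable_smoothed_tail.
  rewrite -[X in measurable X]setTI.
  apply: (measurableT_comp measurable_fst measurable_snd) => //.
transitivity (image_measure m tWa G); first by [].
transitivity ((unif \x nu) G)%E.
  apply: esym.
  by apply: (@product_measure_unique _ _ _ _ R unif nu (image_measure m tWa)).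
(* [G] with its coordinates regrouped, so that its sections over [(u, s)] are the
   sets of scores that [k u] has to measure. *)
pose H := [set x : (U * R) * R | G (x.1.2, (x.1.1, x.2))].
have mH : measurable H.
  rewrite -[X in measurable X]setTI.
  have mp : measurable_fun setT (fun x : (U * R) * R => (x.1.2, (x.1.1, x.2))).
    apply: measurable_fun_pair.
      exact: (measurableT_comp measurable_snd measurable_fst).
    apply: measurable_fun_pair => //.
    exact: (measurableT_comp measurable_fst measurable_fst).
  exact: mp.
pose f (x : U * R) := k x.1 (xsection H x).
transitivity (\int[unif]_s \int[image_measure m W]_u f (u, s))%E.
  apply: eq_integral => s _; apply: eq_integral => u _.
  by rewrite /f !xsectionE.
rewrite -(@fubini_tonelli _ _ _ _ _ (image_measure m W) unif f)//; last first.
  exact: measurable_kernel_family_xsection.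
transitivity (\int[image_measure m W]_(u in C) eps%:E)%E; last first.
  by rewrite integral_cst.
rewrite [RHS]integral_mkcond; apply: eq_integral => u _.
rewrite patchE; case: ifPn => uC.
  rewrite -(smoothed_tail_uniform (kernel_value k u) eps_gt0 eps_lt1).
  apply: eq_integral => s _; rewrite /f xsectionE; congr (k u _).
  apply/seteqP; split => b /=; first by case.
  by move=> ?; split => //=; rewrite inE in uC.
rewrite integral0_eq// => s _; rewrite /f xsectionE.
rewrite (_ : _ @^-1` _ = set0) ?measure0//.
apply/seteqP; split => // b [_ /=] uC'.
by move: uC; rewrite notin_setE.
Qed.

End conditional_rank.

Section image_kernel.
Context d1 d2 d3 (U : measurableType d1) (T : measurableType d2)
  (T' : measurableType d3) (R : realType).
Variables (k : R.-pker U ~> T) (f : {mfun T >-> T'}).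

Definition image_kernel (u : U) : {measure set T' -> \bar R} :=
  image_measure (kernel_value k u) f.

Let measurable_image_kernel B : measurable B ->
  measurable_fun setT (image_kernel ^~ B).
Proof.
move=> mB; apply: (measurable_kernel k).
by rewrite -[X in measurable X]setTI; exact: measurable_funP.
Qed.

HB.instance Definition _ := isKernel.Build _ _ _ _ _ image_kernel
  measurable_image_kernel.

Let image_kernelT u : image_kernel u setT = 1%E.
Proof. exact: prob_kernel. Qed.

HB.instance Definition _ := Kernel_isProbability.Build _ _ _ _ _ image_kernel
  image_kernelT.

End image_kernel.

(** * Conditional independence and conditional distributions *)

Section conditional_independence.
Context d (Om : measurableType d) (R : realType) (P : probability Om R).
Context d3 (U : measurableType d3) (W : {mfun Om >-> U}).
Local Open Scope ereal_scope.

Let mu := image_measure P W.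

(** A version of a conditional probability given [W] is a density with respect to
    the law of [W]. *)
Lemma is_cprob_image E f : is_cprob P W E f ->
  mu.-integrable setT f /\
  forall C, measurable C -> \int[mu]_(u in C) f u = P (E `&` W @^-1` C).
Proof.
move=> [mf intf fE]; split.
  exact: integrable_pushforward.
move=> C mC; rewrite -fE//; apply: integral_pushforward => //.
apply: integrableS intf => //.
by rewrite -[X in measurable X]setTI; exact: measurable_funP.
Qed.

(** Given [W], [Q] stays the conditional distribution of [X] after restricting to
    an event that depends on [Y] only. The versions [f] and [g] supplied by
    conditional independence are replaced, almost everywhere for the law of [W],
    by [Q] and by the Radon-Nikodym derivative of the law of [W] on the event
    [Y \in B]; the product with that derivative integrates against the restricted
    law. *)
Lemma cond_independent_rcd d1 d2 (T1 : measurableType d1)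
    (T2 : measurableType d2) (X : {mfun Om >-> T1}) (Y : {mfun Om >-> T2})
    (Q : R.-pker U ~> T1) :
  is_rcd P X W Q -> cond_independent P X Y W ->
  forall A B C (mYB : measurable (Y @^-1` B)),
  measurable A -> measurable B -> measurable C ->
  P (X @^-1` A `&` Y @^-1` B `&` W @^-1` C) =
  \int[mrestr P mYB]_(w in W @^-1` C) Q (W w) A.
Proof.
move=> rcdQ indXY A B C mYB mA mB mC.
have [f [g [/is_cprob_image[intf fE] /is_cprob_image[intg gE]]]] := indXY _ _ mA mB.
move=> /is_cprob_image[intfg fgE].
have /is_cprob_image[intq qE] := rcdQ _ mA.
pose nu := image_measure (mrestr P mYB) W.
have nuE D : nu D = P (Y @^-1` B `&` W @^-1` D) by rewrite setIC.
pose RN := Radon_Nikodym (charge_of_finite_measure nu) mu.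
have numu : nu `<< mu.
  apply/null_content_dominatesP => D mD muD0.
  apply/eqP; rewrite eq_le measure_ge0 andbT -muD0 nuE; apply: le_measure => //.
  - rewrite inE; apply: measurableI => //.
    by rewrite -[X in measurable X]setTI; exact: measurable_funP.
  - by rewrite inE -[X in measurable X]setTI; exact: measurable_funP.
have iRN : mu.-integrable setT RN by exact: Radon_Nikodym_integrable.
have mRN := measurable_int _ iRN.
have fq : ae_eq mu setT f (Q ^~ A).
  apply: integral_ae_eq => //; first exact: (measurable_int _ intq).
  by move=> E _ mE; rewrite fE// qE.
have gRN : ae_eq mu setT g RN.
  apply: integral_ae_eq => // E _ mE; rewrite gE//.
  by rewrite -[RHS]Radon_Nikodym_integral.
rewrite -fgE//.
transitivity (\int[mu]_(u in C)
    (Q u A * RN u)).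
  apply: ae_eq_integral => //.
  - apply/measurable_funTS; exact: (measurable_int _ intfg).
  - apply/measurable_funTS/emeasurable_funM => //; exact: (measurable_int _ intq).
  - by move: fq gRN; apply: filterS2 => u fu gu _; rewrite fu// gu.
rewrite Radon_Nikodym_change_of_variables//.
  rewrite ge0_integral_image//.
  by apply/measurable_funTS/measurable_kernel.
apply: (@le_integrable _ _ _ _ _ mC _ (cst 1)).
- by apply/measurable_funTS/measurable_kernel.
- move=> u _; rewrite gee0_abs//= normr1 -(@prob_kernel _ _ _ _ _ Q u).
  by apply: le_measure; rewrite ?inE.
- exact: finite_measure_integrable_cst.
Qed.

End conditional_independence.

(** * Sequences of random variables *)

Section sequence_space.
Context d (T : measurableType d).

Lemma measurable_coord i : measurable_fun setT (fun z : seqspace T => z i).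
Proof.
move=> _ B mB; apply: sub_sigma_algebra; exists i => //.
by exists B.
Qed.

Lemma measurable_fun_seqspace d1 (X : measurableType d1) (f : X -> seqspace T) :
  (forall i, measurable_fun setT (fun x => f x i)) -> measurable_fun setT f.
Proof.
move=> mf; apply: (measurability (cylinders T : set (set (seqspace T)))) => //.
move=> _ [_ [i _ [B mB <-]] <-]; rewrite !setTI.
by rewrite -[X in measurable X]setTI; exact: mf.
Qed.

Lemma measurable_first_obs n :
  measurable_fun setT (fun z : seqspace T => first_obs n z).
Proof.
apply/measurable_fun_tnthP => i.
rewrite (_ : _ \o _ = fun z : seqspace T => z i); first exact: measurable_coord.
by apply/funext => z /=; rewrite tnth_mktuple.
Qed.

Lemma measurable_later_obs n :
  measurable_fun setT (fun z : seqspace T => later_obs n z : seqspace T).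
Proof. by apply: measurable_fun_seqspace => i; exact: measurable_coord. Qed.

Definition finite_cylinders : set (set (seqspace T)) :=
  [set D | exists (N : nat) (B : nat -> set T), (forall i, measurable (B i)) /\
    D = [set z | forall i, (i < N)%N -> B i (z i)]].

Lemma finite_cylinders_setT : finite_cylinders setT.
Proof.
exists 0%N, (fun=> setT); split=> //.
by apply/seteqP; split.
Qed.

Lemma finite_cylinders_setI : setI_closed finite_cylinders.
Proof.
move=> _ _ [N1 [B1 [mB1 ->]]] [N2 [B2 [mB2 ->]]].
exists (maxn N1 N2), (fun i => (if (i < N1)%N then B1 i else setT) `&`
  (if (i < N2)%N then B2 i else setT)); split.
  by move=> i; apply: measurableI; case: ifP.
apply/seteqP; split => z /=.
  by case=> z1 z2 i _; split; case: ifP => //; [exact: z1|exact: z2].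
move=> H; split => i iN; have := H i; rewrite leq_max iN ?orbT => /(_ isT)[].
  by [].
by [].
Qed.

Lemma measurable_finite_cylinders :
  @measurable _ (seqspace T) = <<s finite_cylinders >>.
Proof.
apply/seteqP; split.
  apply: smallest_sub; first exact: smallest_sigma_algebra.
  move=> _ [i _ [B mB <-]]; apply: sub_sigma_algebra.
  exists i.+1, (fun j => if j == i then B else setT); split.
    by move=> j; case: ifP.
  apply/seteqP; split => z /=.
    by case=> _ Bz j _; case: eqP => // ->.
  by move=> /(_ i (ltnSn i)); rewrite eqxx => Bz; split.
apply: smallest_sub; first exact: sigma_algebra_measurable.
move=> _ [N [B [mB ->]]].
rewrite (_ : [set _ | _] = \bigcap_(i in `I_N) ((fun z : seqspace T => z i) @^-1` B i)).
  apply: bigcap_measurableType.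
  by move=> i _; rewrite -[X in measurable X]setTI; exact: measurable_coord.
by apply/seteqP; split => z /= H i; exact: H.
Qed.

Lemma eq_measure_seqspace (R : realType)
    (m1 m2 : {measure set (seqspace T) -> \bar R}) :
  (m1 setT < +oo)%E -> (forall D, finite_cylinders D -> m1 D = m2 D) ->
  forall D, measurable D -> m1 D = m2 D.
Proof.
move=> m1T m12 D mD.
apply: (measure_unique finite_cylinders (fun=> setT)) => //.
- exact: measurable_finite_cylinders.
- exact: finite_cylinders_setI.
- by move=> _; exact: finite_cylinders_setT.
- by rewrite bigcup_const//; exists 0%N.
Qed.

End sequence_space.

Section interval_independence.
Context d (Om : measurableType d) (R : realType) (P : probability Om R).
Context d1 (T : measurableType d1) (X : nat -> Om -> T).
Local Open Scope ereal_scope.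

Lemma mutually_independent_interval n N (B : nat -> set T) :
  mutually_independent P X -> (forall i, measurable (B i)) ->
  P [set w | forall i, (i < N)%N -> B (n + i)%N (X (n + i)%N w)] =
  \prod_(i <- iota n N) P (X i @^-1` B i).
Proof.
move=> indX mB.
have := indX [fset i in iota n N]%fset B (fun i _ => mB i).
rewrite (perm_big (iota n N))/=; last first.
  apply: uniq_perm; [exact: fset_uniq|exact: iota_uniq|].
  by move=> i; rewrite !inE.
move=> <-; congr (P _); apply/seteqP; split => w /= H i.
  rewrite /= !inE mem_iota => /andP[ni iN].
  have := H (i - n)%N; rewrite subnKC//; apply.
  by rewrite ltn_subLR.
by move=> iN; apply: H; rewrite /= !inE mem_iota leq_addr ltn_add2l.
Qed.

(** An arbitrary finite index set is padded to an initial segment by putting no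
    constraint on the missing indices. *)
Lemma interval_mutually_independent :
  (forall N (B : nat -> set T), (forall i, measurable (B i)) ->
    P [set w | forall i, (i < N)%N -> B i (X i w)] =
    \prod_(i <- iota 0 N) P (X i @^-1` B i)) ->
  mutually_independent P X.
Proof.
move=> H J B mB.
pose B' i := if i \in J then B i else setT.
pose N := (\max_(i <- J) i).+1.
have JN i : i \in J -> (i < N)%N by move=> iJ; rewrite ltnS; exact: leq_bigmax_seq.
have mB' i : measurable (B' i) by rewrite /B'; case: ifPn => // /mB.
have := H N B' mB'.
rewrite (_ : [set _ | _] = \bigcap_(i in [set` J]) (X i @^-1` B i)); last first.
  apply/seteqP; split => w /= Hw i.
    by move=> iJ; have := Hw i (JN i iJ); rewrite /B' iJ.
  by move=> _; rewrite /B'; case: ifPn => // /Hw.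
move=> ->.
have Jr i : i \in J -> i \in iota 0 N by move=> /JN; rewrite mem_iota.
move: (iota 0 N) (iota_uniq 0 N) Jr => r r_uniq Jr.
rewrite (bigID (mem J))/= [X in _ * X]big1 ?mule1; last first.
  by move=> i iJ; rewrite /B' (negbTE iJ) preimage_setT probability_setT.
rewrite -big_filter (perm_big J)/=; last first.
  apply: uniq_perm; [exact: filter_uniq|exact: fset_uniq|].
  move=> i; rewrite mem_filter.
  by apply/andP/idP => [[]//|iJ]; split => //; exact: Jr.
by apply: eq_big_seq => i iJ; rewrite /B' iJ.
Qed.

End interval_independence.

Section independent_tail.
Context d (Om : measurableType d) (R : realType) (P : probability Om R).
Context d1 (T : measurableType d1) (X : {mfun Om >-> seqspace T}).
Local Open Scope ereal_scope.

(** For [D] a finite cylinder this is mutual independence of finitely many terms;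
    finite cylinders form a pi-system that generates the product sigma-algebra. *)
Lemma mutually_independent_tail n (F : set T) (D : set (seqspace T)) :
  mutually_independent P (fun n w => X w n) -> measurable F -> measurable D ->
  P ([set w | F (X w n)] `&` [set w | D (later_obs n.+1 (X w))]) =
  P [set w | F (X w n)] * P [set w | D (later_obs n.+1 (X w))].
Proof.
move=> indX mF mD.
have mXn : measurable [set w | F (X w n)].
  rewrite -[X in measurable X]setTI.
  exact: (measurableT_comp (@measurable_coord _ T n) (@measurable_funPT _ _ _ _ X)).
have mL : measurable_fun setT (fun w => later_obs n.+1 (X w) : seqspace T).
  exact: (measurableT_comp (@measurable_later_obs _ T n.+1)
    (@measurable_funPT _ _ _ _ X)).
pose mLI := isMeasurableFun.Build _ _ _ _ _ mL.
pose L : {mfun Om >-> seqspace T} :=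
  HB.pack (fun w => later_obs n.+1 (X w) : seqspace T) mLI.
have PF : (0 <= fine (P [set w | F (X w n)]))%R by rewrite fine_ge0.
transitivity (mscale (NngNum PF) (image_measure P L) D); last first.
  by rewrite /mscale/= fineK// fin_num_measure.
rewrite setIC.
apply: (eq_measure_seqspace (m1 := image_measure (mrestr P mXn) L)) => //.
  by rewrite ltey_eq fin_num_measure.
move=> _ [N [B [mB ->]]].
rewrite /image_measure /pushforward/= /mrestr/= /mscale/= fineK ?fin_num_measure//.
pose B' i := if i == n then F else B (i - n.+1)%N.
have mB' i : measurable (B' i) by rewrite /B'; case: ifP.
transitivity (P [set w | forall i, (i < N.+1)%N -> B' (n + i)%N (X w (n + i)%N)]).
  congr (P _); apply/seteqP; split => w /=.
    move=> [H Fw] [|i] iN; first by rewrite addn0 /B' eqxx.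
    rewrite /B' addnS gtn_eqF ?ltnS ?leq_addr// subSS addKn.
    by have := H i iN; rewrite /later_obs addSn.
  move=> H; split; last by have := H 0%N isT; rewrite addn0 /B' eqxx.
  move=> i iN; have := H i.+1 iN.
  by rewrite /B' addnS gtn_eqF ?ltnS ?leq_addr// subSS addKn /later_obs addSn.
rewrite (mutually_independent_interval n N.+1 indX)//= big_cons.
rewrite -(mutually_independent_interval n.+1 N indX)//; congr (_ * _).
  by rewrite /B' eqxx.
congr (P _); apply/seteqP; split => w /= H i iN; have := H i iN.
  by rewrite /B' gtn_eqF ?addSn ?ltnS ?leq_addr// subSS addKn.
by rewrite /B' gtn_eqF ?addSn ?ltnS ?leq_addr// subSS addKn.
Qed.

End independent_tail.

Section bernoulli.
Context d (Om : measurableType d) (R : realType) (Pr : probability Om R).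
Local Open Scope ereal_scope.

Lemma bernoulli_indicator (e : Om -> bool) (T : set Om) (eps : R) (B : set bool) :
  (0 <= eps <= 1)%R -> measurable [set w | e w] -> measurable T ->
  Pr ([set w | e w] `&` T) = eps%:E * Pr T ->
  Pr ([set w | B (e w)] `&` T) = bernoulli_prob eps B * Pr T.
Proof.
move=> eps01 me mT eT; rewrite bernoulli_probE// !diracE.
have eC : Pr ([set w | ~~ e w] `&` T) = (1 - eps)%:E * Pr T.
  have -> : [set w | ~~ e w] `&` T = T `\` ([set w | e w] `&` T).
    apply/seteqP; split => w /=; first by case=> /negP ew Tw; split => // -[].
    by case=> Tw ew; split => //; apply/negP => ?; exact: ew.
  rewrite measureD//; [|exact: measurableI|by rewrite ltey_eq fin_num_measure].
  rewrite [X in _ - X](_ : _ = eps%:E * Pr T); last first.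
    by rewrite setICA setIid; exact: eT.
  rewrite -[X in X - _]mul1e -muleBl//.
  by rewrite fin_num_measure.
have [Bt|Bt] := boolP (true \in B); have [Bf|Bf] := boolP (false \in B);
  rewrite ?mule1 ?mule0 ?adde0 ?add0e.
- rewrite (_ : [set w | B (e w)] = setT) ?setTI; last first.
    apply/seteqP; split => // w _ /=; rewrite !inE in Bt Bf.
    by case: (e w).
  by rewrite -EFinD addrC subrK mul1e.
- rewrite -[RHS]eT; congr (Pr (_ `&` _)); apply/seteqP; split => w /=;
    rewrite inE in Bt; rewrite notin_setE in Bf; by case: (e w).
- rewrite -[RHS]eC; congr (Pr (_ `&` _)); apply/seteqP; split => w /=;
    rewrite inE in Bf; rewrite notin_setE in Bt; by case: (e w).
- rewrite (_ : [set w | B (e w)] = set0) ?set0I ?measure0 ?mul0e//.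
  apply/seteqP; split => // w /=; rewrite !notin_setE in Bt Bf.
  by case: (e w).
Qed.

End bernoulli.

(** * Errors of a smoothed conformal predictor *)

Section conformal_prediction.
Context (R : realType) dZ (Z : measurableType dZ).
Context (dS : nat -> measure_display) (Sigma : forall n, measurableType (dS n)).
Variable S : forall n, {mfun n.-tuple Z >-> Sigma n}.
Variable model : set (probability (seqspace Z) R).
Hypothesis S_ATTS : ATTS S model.
Variable A : forall n, {mfun (Sigma n * Z)%type >-> R}.
Variable Q : forall n, R.-pker (Sigma n) ~> (n.-tuple Z).
Hypothesis Q_rcd : forall n, (0 < n)%N -> common_rcd S model (Q n).
Variable P : probability (seqspace Z) R.
Hypothesis P_model : model P.
Context d (Om : measurableType d) (Pr : probability Om R).
Variable zeta : {mfun Om >-> seqspace Z}.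
Hypothesis zeta_law : forall B, measurable B -> distribution Pr zeta B = P B.
Variable tau : {mfun Om >-> seqspace R}.
Hypothesis tau_law : iid Pr (fun n w => tau w n) (uniform_prob (@ltr01 R)).
Hypothesis zeta_tau_indep : independent_pair Pr zeta tau.
Variable eps : R.
Hypotheses (eps_gt0 : 0 < eps) (eps_lt1 : eps < 1).

Lemma measurable_tinit n : measurable_fun setT (@tinit Z n).
Proof.
apply/measurable_fun_tnthP => i.
rewrite (_ : _ \o _ = fun z : n.+1.-tuple Z => tnth z (widen_ord (leqnSn n) i)).
  exact: measurable_tnth.
by apply/funext => z /=; rewrite tnth_mktuple.
Qed.

Lemma measurable_score n : measurable_fun setT (@score R _ Z _ Sigma S A n).
Proof.
apply: measurableT_comp => //; apply: measurable_fun_pair.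
  exact: (measurableT_comp (@measurable_funPT _ _ _ _ (S n)) (@measurable_tinit n)).
exact: measurable_tnth.
Qed.

Let score_mfun n : {mfun n.+1.-tuple Z >-> R} := HB.pack (score S A (n := n))
  (isMeasurableFun.Build _ _ _ _ (score S A (n := n)) (@measurable_score n)).

Let score_kernel n : R.-pker (Sigma n.+1) ~> R :=
  image_kernel (Q n.+1) (score_mfun n).

Let stat n (z : seqspace Z) : Sigma n := S n (first_obs n z).

Let mstat n : measurable_fun setT (stat n).
Proof.
exact: (measurableT_comp (@measurable_funPT _ _ _ _ (S n)) (@measurable_first_obs _ Z n)).
Qed.

Let pvalueE n (z : n.+1.-tuple Z) t :
  pvalue S A Q z t = smoothed_tail (score_kernel n (S n.+1 z)) (score S A z) t.
Proof. by []. Qed.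

Let mzeta : measurable_fun setT zeta.
Proof. exact: measurable_funPT. Qed.

Let mtau : measurable_fun setT tau.
Proof. exact: measurable_funPT. Qed.

(** All that matters for the steps after the first [n]. *)
Definition future n (w : Om) : (Sigma n * seqspace Z) * seqspace R :=
  ((stat n (zeta w), later_obs n (zeta w)), later_obs n (tau w)).

Lemma measurable_future n : measurable_fun setT (future n).
Proof.
apply: measurable_fun_pair; first apply: measurable_fun_pair.
- exact: (measurableT_comp (@mstat n) mzeta).
- exact: (measurableT_comp (@measurable_later_obs _ Z n) mzeta).
- exact: (measurableT_comp (@measurable_later_obs _ R n) mtau).
Qed.

(** The error at step [n+1], over an arbitrary observation space. *)
Definition miss n (w : Om) : bool :=
  pvalue S A Q (first_obs n.+1 (zeta w)) (tau w n) <= eps.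

Let W n w := stat n (zeta w).
Let a n w := score S A (first_obs n.+1 (zeta w)).
Let t n w := tau w n.

Let mW n : measurable_fun setT (W n).
Proof. exact: (measurableT_comp (@mstat n) mzeta). Qed.

Let ma n : measurable_fun setT (a n).
Proof.
apply: (measurableT_comp (@measurable_score n)).
exact: (measurableT_comp (@measurable_first_obs _ Z n.+1) mzeta).
Qed.

Let mt n : measurable_fun setT (t n).
Proof. exact: (measurableT_comp (@measurable_coord _ R n) mtau). Qed.

Lemma measurable_miss n : measurable [set w | miss n w].
Proof.
rewrite -[X in measurable X]setTI.
apply: (@measurable_fun_le _ _ _ _
  (fun w => smoothed_tail (score_kernel n (W n.+1 w)) (a n w) (t n w))) => //.
have mtWa : measurable_fun setT (fun w => (t n w, (W n.+1 w, a n w))).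
  by apply: measurable_fun_pair => //; apply: measurable_fun_pair.
exact: (measurableT_comp (measurable_smoothed_tail (score_kernel n)) mtWa).
Qed.

Section rectangle.
Variables (n : nat) (B : set (seqspace Z)) (L : set (seqspace R)).
Hypotheses (mB : measurable B) (mL : measurable L).
Local Open Scope ereal_scope.

Let YB : set (seqspace Z) := later_obs n.+1 @^-1` B.
Let LL : set (seqspace R) := later_obs n.+1 @^-1` L.

Let mYB : measurable YB.
Proof.
rewrite -[X in measurable X]setTI.
exact: (@measurable_later_obs _ Z n.+1).
Qed.

Let mLL : measurable LL.
Proof.
rewrite -[X in measurable X]setTI.
exact: (@measurable_later_obs _ R n.+1).
Qed.

Let G := zeta @^-1` YB `&` tau @^-1` LL.

Let mG : measurable G.
Proof.
apply: measurableI; rewrite -[X in measurable X]setTI.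
  exact: mzeta.
exact: mtau.
Qed.

Let PzetaE E F : measurable E -> measurable F ->
  Pr (zeta @^-1` E `&` tau @^-1` F) = P E * Pr (tau @^-1` F).
Proof. by move=> mE mF; rewrite zeta_tau_indep// -zeta_law. Qed.

Let zeta_restr E : measurable E ->
  image_measure (mrestr Pr mG) zeta E = Pr (tau @^-1` LL) * mrestr P mYB E.
Proof.
move=> mE; rewrite /image_measure /pushforward/= /mrestr/= muleC -PzetaE//.
  by rewrite /G setIA -preimage_setI.
exact: measurableI.
Qed.

(** The factor is the probability of [L]: the random numbers are independent of
    the observations, so restricting to an event of the former rescales the law
    of the latter. *)
Let integral_restr (C : set (Sigma n.+1)) (f : Sigma n.+1 -> \bar R) :
  measurable C -> measurable_fun setT f -> (forall u, 0 <= f u) ->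
  \int[mrestr Pr mG]_(w in W n.+1 @^-1` C) f (W n.+1 w) =
  Pr (tau @^-1` LL) * \int[mrestr P mYB]_(z in stat n.+1 @^-1` C) f (stat n.+1 z).
Proof.
move=> mC mf f0.
have mSC : measurable (stat n.+1 @^-1` C).
  by rewrite -[X in measurable X]setTI; exact: mstat.
have mfS : measurable_fun setT (f \o stat n.+1).
  exact: measurableT_comp.
have c0 : (0 <= fine (Pr (tau @^-1` LL)))%R by rewrite fine_ge0.
have mTL : measurable (tau @^-1` LL).
  by rewrite -[X in measurable X]setTI; exact: mtau.
transitivity (\int[image_measure (mrestr Pr mG) zeta]_(z in stat n.+1 @^-1` C)
    f (stat n.+1 z)).
  rewrite ge0_integral_image//; exact: measurable_funTS.
transitivity (\int[mscale (NngNum c0) (mrestr P mYB)]_(z in stat n.+1 @^-1` C)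
    f (stat n.+1 z)).
  apply: eq_measure_integral => E mE _; apply: etrans (zeta_restr mE) _.
  by rewrite /mscale; congr (_ * _); rewrite /= fineK// fin_num_measure.
rewrite ge0_integral_mscale//=; last exact: measurable_funTS.
by rewrite fineK// fin_num_measure.
Qed.

(** Total sufficiency (for [B]) and independence of the random numbers (for [L])
    give the hypothesis of [smoothed_rank_uniform] under [Pr] restricted to
    [G]. *)
Let joint (C : set (Sigma n.+1)) (D F : set R) :
  measurable C -> measurable D -> measurable F ->
  mrestr Pr mG (t n @^-1` F `&` (W n.+1 @^-1` C `&` a n @^-1` D)) =
  unit_uniform R F *
    \int[mrestr Pr mG]_(w in W n.+1 @^-1` C) score_kernel n (W n.+1 w) D.
Proof.
move=> mC mD mF.
pose X (z : seqspace Z) : n.+1.-tuple Z := first_obs n.+1 z.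
pose E := score_mfun n @^-1` D.
have mE : measurable E.
  by rewrite -[X in measurable X]setTI; exact: measurable_funP.
have mXE : measurable (X @^-1` E).
  by rewrite -[X in measurable X]setTI; exact: measurable_first_obs.
have mSC : measurable (stat n.+1 @^-1` C).
  by rewrite -[X in measurable X]setTI; exact: mstat.
have mFn : measurable [set s : seqspace R | F (s n)].
  by rewrite -[X in measurable X]setTI; exact: measurable_coord.
rewrite (integral_restr mC (f := score_kernel n ^~ D))//; last first.
  exact: measurable_kernel.
transitivity (Pr (zeta @^-1` (X @^-1` E `&` YB `&` stat n.+1 @^-1` C) `&`
    tau @^-1` ([set s | F (s n)] `&` LL))).
  congr (Pr _); apply/seteqP; split => w /=.
    by case=> -[Ft [Cw Dw]] [Yw Lw].
  by case=> -[[Dw Yw] Cw] [Ft Lw].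
rewrite PzetaE; [|by apply: measurableI => //; exact: measurableI|exact: measurableI].
have [_ tau_indep tau_unif] := tau_law.
have -> : Pr (tau @^-1` ([set s | F (s n)] `&` LL)) =
    unit_uniform R F * Pr (tau @^-1` LL).
  rewrite preimage_setI.
  have := mutually_independent_tail (X := tau) n tau_indep mF mL.
  by move=> ->; congr (_ * _); exact: tau_unif.
have [_ /(_ P P_model) indS] : sufficient S model n.+1 /\ _ :=
  (let: And3 _ _ h := S_ATTS in h n.+1 isT).
have -> : P (X @^-1` E `&` YB `&` stat n.+1 @^-1` C) =
    \int[mrestr P mYB]_(z in stat n.+1 @^-1` C) score_kernel n (stat n.+1 z) D.
  pose X' : {mfun seqspace Z >-> n.+1.-tuple Z} := HB.pack X
    (isMeasurableFun.Build _ _ _ _ X (@measurable_first_obs _ Z n.+1)).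
  pose Y' : {mfun seqspace Z >-> seqspace Z} :=
    HB.pack (fun z => later_obs n.+1 z : seqspace Z)
    (isMeasurableFun.Build _ _ _ _ _ (@measurable_later_obs _ Z n.+1)).
  pose S' : {mfun seqspace Z >-> Sigma n.+1} := HB.pack (stat n.+1)
    (isMeasurableFun.Build _ _ _ _ (stat n.+1) (@mstat n.+1)).
  transitivity (\int[mrestr P mYB]_(z in S' @^-1` C) Q n.+1 (S' z) E); last by [].
  apply: (@cond_independent_rcd _ _ _ P _ _ S' _ _ _ _ X' Y' (Q n.+1)
    (Q_rcd (ltn0Sn n) P_model) indS E B C mYB mE mB mC).
by rewrite muleC -muleA.
Qed.

Lemma miss_rectangle C : measurable C ->
  Pr ([set w | miss n w] `&` future n.+1 @^-1` ((C `*` B) `*` L)) =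
  eps%:E * Pr (future n.+1 @^-1` ((C `*` B) `*` L)).
Proof.
move=> mC.
pose W' : {mfun Om >-> Sigma n.+1} := HB.pack (W n.+1)
  (isMeasurableFun.Build _ _ _ _ (W n.+1) (@mW n.+1)).
pose a' : {mfun Om >-> R} := HB.pack (a n)
  (isMeasurableFun.Build _ _ _ _ (a n) (@ma n)).
pose t' : {mfun Om >-> R} := HB.pack (t n)
  (isMeasurableFun.Build _ _ _ _ (t n) (@mt n)).
have := @smoothed_rank_uniform _ _ _ _ _ (mrestr Pr mG) (score_kernel n) W' a' t'
  joint eps eps_gt0 eps_lt1 C mC.
rewrite /mrestr /= => H.
transitivity (eps%:E * Pr (W n.+1 @^-1` C `&` G)).
  rewrite -H; congr (Pr _); apply/seteqP; split => w /=.
    by case=> ? [[? ?] ?].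
  by case=> -[? ?] [? ?].
congr (_ * Pr _); apply/seteqP; split => w /=.
  by case=> ? [? ?].
by case=> -[? ?] ?.
Qed.

End rectangle.

(** Both sides are finite measures in [D]. On a rectangle, the parts of the event
    about later observations and later random numbers can be conditioned on
    first, which leaves the law of the p-value given [S n.+1]. *)
Lemma miss_independent_of_future n D : measurable D ->
  (Pr ([set w | miss n w] `&` future n.+1 @^-1` D) =
   eps%:E * Pr (future n.+1 @^-1` D))%E.
Proof.
move=> mD.
pose V : {mfun Om >-> ((Sigma n.+1 * seqspace Z) * seqspace R)%type} :=
  HB.pack (future n.+1)
  (isMeasurableFun.Build _ _ _ _ (future n.+1) (@measurable_future n.+1)).
have eps0 := ltW eps_gt0.
transitivity (image_measure (mrestr Pr (@measurable_miss n)) V D).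
  by rewrite /image_measure /pushforward /mrestr setIC.
transitivity (mscale (NngNum eps0) (image_measure Pr V) D); last by [].
apply: eq_measure_prod3 => // C B L mC mB mL.
rewrite [LHS](_ : _ = Pr ([set w | miss n w] `&` future n.+1 @^-1` ((C `*` B) `*` L))).
  exact: miss_rectangle.
by rewrite /= /image_measure /pushforward /mrestr setIC.
Qed.

Definition future_event n : set (set Om) :=
  [set E | exists2 D, measurable D & E = future n @^-1` D].

Lemma tinit_first_obs n (z : nat -> Z) : tinit (first_obs n.+1 z) = first_obs n z.
Proof. by apply: eq_from_tnth => i; rewrite !tnth_mktuple. Qed.

Lemma tlast_first_obs n (z : nat -> Z) : tlast (first_obs n.+1 z) = z n.
Proof. by rewrite /tlast tnth_mktuple. Qed.

Let stat_step n : (0 < n)%N ->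
  exists F : {mfun (Sigma n * Z)%type >-> Sigma n.+1},
    forall w, W n.+1 w = F (W n w, zeta w n).
Proof.
have [_ + _] := S_ATTS => /[apply] -[F SF]; exists F => w.
by rewrite /W /stat SF tinit_first_obs tlast_first_obs.
Qed.

Let next n (v : (Sigma n * seqspace Z) * seqspace R) : Sigma n * Z :=
  (v.1.1, v.1.2 0%N).

Let mnext n : measurable_fun setT (@next n).
Proof.
have m1 : measurable_fun setT
  (@fst (Sigma n * seqspace Z)%type (seqspace R)) by [].
apply: measurable_fun_pair.
  exact: (measurableT_comp measurable_fst m1).
exact: (measurableT_comp (@measurable_coord _ Z 0) (measurableT_comp measurable_snd m1)).
Qed.

Let next_future n w : next (future n w) = (W n w, zeta w n).
Proof. by rewrite /next/= /later_obs addn0. Qed.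

(** Algebraic transitivity recovers [S n.+1] from [S n] and the next observation,
    so the future at time [n+1] is a function of the one at time [n]. *)
Lemma future_eventS n E : (0 < n)%N -> future_event n.+1 E -> future_event n E.
Proof.
move=> /stat_step[F WF] [D mD ->].
pose shift (v : (Sigma n * seqspace Z) * seqspace R) :
    (Sigma n.+1 * seqspace Z) * seqspace R :=
  ((F (next v), later_obs 1 v.1.2), later_obs 1 v.2).
have mshift : measurable_fun setT shift.
  have m1 : measurable_fun setT
    (@fst (Sigma n * seqspace Z)%type (seqspace R)) by [].
  apply: measurable_fun_pair; first apply: measurable_fun_pair.
  - exact: (measurableT_comp (@measurable_funPT _ _ _ _ F) (@mnext n)).
  - exact: (measurableT_comp (@measurable_later_obs _ Z 1)
      (measurableT_comp measurable_snd m1)).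
  - exact: (measurableT_comp (@measurable_later_obs _ R 1) measurable_snd).
exists (shift @^-1` D).
  by rewrite -[X in measurable X]setTI; exact: mshift.
have later_later T (z : nat -> T) : later_obs 1 (later_obs n z) = later_obs n.+1 z.
  by apply/funext => i; rewrite /later_obs addnA addn1.
rewrite -comp_preimage; congr (_ @^-1` D); apply/funext => w.
rewrite /shift/= next_future -WF.
by rewrite /future !later_later.
Qed.

(** Both [S n.+1] and the score at step [n+1] are functions of [S n] and the
    next observation. For [n = 0] algebraic transitivity says nothing, and only
    errors after the first one have to belong to a future. *)
Lemma future_event_miss n (B : set bool) : (0 < n)%N ->
  future_event n [set w | B (miss n w)].
Proof.
move=> /stat_step[F WF].
pose rank (v : (Sigma n * seqspace Z) * seqspace R) : R :=
  smoothed_tail (score_kernel n (F (next v))) (A n (next v)) (v.2 0%N).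
have mrank : measurable_fun setT rank.
  have mv : measurable_fun setT (fun v : (Sigma n * seqspace Z) * seqspace R =>
      (v.2 0%N, (F (next v), A n (next v)))).
    apply: measurable_fun_pair; last apply: measurable_fun_pair.
    - exact: (measurableT_comp (@measurable_coord _ R 0) measurable_snd).
    - exact: (measurableT_comp (@measurable_funPT _ _ _ _ F) (@mnext n)).
    - exact: (measurableT_comp (@measurable_funPT _ _ _ _ (A n)) (@mnext n)).
  exact: (measurableT_comp (measurable_smoothed_tail (score_kernel n)) mv).
have mle : measurable_fun setT (fun v => rank v <= eps).
  exact: measurable_fun_ler.
exists ((fun v => rank v <= eps) @^-1` B).
  by rewrite -[X in measurable X]setTI; exact: mle.
apply/seteqP; suff E w : miss n w = (rank (future n w) <= eps).
  by split => w /=; rewrite E.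
rewrite /miss pvalueE /rank next_future -WF.
by rewrite /score tinit_first_obs tlast_first_obs /= /later_obs addn0.
Qed.

Lemma future_event_setI n E E' : future_event n E -> future_event n E' ->
  future_event n (E `&` E').
Proof.
move=> [D mD ->] [D' mD' ->]; exists (D `&` D') => //.
exact: measurableI.
Qed.

Lemma future_event_setT n : future_event n setT.
Proof. by exists setT. Qed.

Let run n N (B : nat -> set bool) : set Om :=
  [set w | forall i, (i < N)%N -> B (n + i)%N (miss (n + i) w)].

Let runS n N B : run n N.+1 B = [set w | B n (miss n w)] `&` run n.+1 N B.
Proof.
apply/seteqP; split => w /=.
  move=> H; split; first by have := H 0%N isT; rewrite addn0.
  by move=> i iN; have := H i.+1 iN; rewrite addnS.
case=> H0 H [|i] iN; first by rewrite addn0.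
by rewrite addnS; exact: H.
Qed.

Let future_event_run n N B : (0 < n)%N -> future_event n (run n N B).
Proof.
elim: N n => [|N IH] n n0.
  rewrite (_ : run _ _ _ = setT); first exact: future_event_setT.
  by apply/seteqP; split.
rewrite runS; apply: future_event_setI; first exact: future_event_miss.
by apply: future_eventS => //; exact: IH.
Qed.

Let miss_future n (B : set bool) E : future_event n.+1 E ->
  (Pr ([set w | B (miss n w)] `&` E) = bernoulli_prob eps B * Pr E)%E.
Proof.
move=> [D mD ->]; apply: bernoulli_indicator.
- by rewrite !ltW.
- exact: measurable_miss.
- by rewrite -[X in measurable X]setTI; exact: measurable_future.
- exact: miss_independent_of_future.
Qed.

Lemma miss_law n (B : set bool) :
  Pr [set w | B (miss n w)] = bernoulli_prob eps B.
Proof.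
rewrite -[X in Pr X]setIT miss_future; last exact: future_event_setT.
by rewrite probability_setT mule1.
Qed.

(** The earliest error splits off because the others lie in its future. *)
Let run_law n N B :
  (Pr (run n N B) = \prod_(i <- iota n N) Pr [set w | B i (miss i w)])%E.
Proof.
elim: N n => [|N IH] n.
  rewrite big_nil (_ : run _ _ _ = setT) ?probability_setT//.
  by apply/seteqP; split.
rewrite runS miss_future; last exact: future_event_run.
by rewrite /= big_cons IH miss_law.
Qed.

Theorem miss_iid : iid Pr (fun n w => miss n w) (bernoulli_prob eps).
Proof.
split.
- move=> n _ B _; rewrite setTI.
  have -> : miss n @^-1` B = [set w | B (miss n w)] by [].
  rewrite (_ : [set w | B (miss n w)] =
    [set w | miss n w] `&` [set _ | B true] `|`
    ~` [set w | miss n w] `&` [set _ | B false]).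
    have mcst (p : Prop) : measurable [set _ : Om | p].
      have [hp|hp] := pselect p.
        by rewrite (_ : [set _ | _] = setT)//; apply/seteqP; split.
      by rewrite (_ : [set _ | _] = set0)//; apply/seteqP; split.
    by apply: measurableU; apply: measurableI => //;
      [exact: measurable_miss|exact/measurableC/measurable_miss].
  apply/seteqP; split => w /=; case: (miss n w) => //.
  - by left.
  - by right.
  - by case=> -[].
  - by case=> -[].
- apply: interval_mutually_independent => N B mB.
  exact: run_law.
- by move=> n B _; exact: miss_law.
Qed.

End conformal_prediction.

Lemma first_obs_rcons T n (z : nat -> T) :
  [tuple of rcons (first_obs n z) (z n)] = first_obs n.+1 z.
Proof.
apply: eq_from_tnth => i; rewrite [RHS]tnth_mktuple (tnth_nth (z n))/=.
rewrite nth_rcons size_map size_enum_ord; case: ltngtP => [i_n|n_i|->//].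
  by rewrite (nth_map (Ordinal i_n)) ?size_enum_ord// nth_enum_ord.
by have := ltn_ord i; rewrite ltnS leqNgt n_i.
Qed.

Theorem corollary1 (R : realType) (K : nat)
  (model : set (probability (seqspace (obs R K)) R))
  (dS : nat -> measure_display) (Sigma : forall n, measurableType (dS n))
  (S : forall n, {mfun n.-tuple (obs R K) >-> Sigma n})
  (S_ATTS : ATTS S model)
  (A : forall n, {mfun (Sigma n * obs R K)%type >-> R})
  (Q : forall n, R.-pker (Sigma n) ~> (n.-tuple (obs R K)))
  (Q_rcd : forall n, (0 < n)%N -> common_rcd S model (Q n))
  (P : probability (seqspace (obs R K)) R) (P_model : model P)
  (d : measure_display) (Om : measurableType d) (Pr : probability Om R)
  (zeta : {RV Pr >-> seqspace (obs R K)})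
  (zeta_law : forall B, measurable B -> distribution Pr zeta B = P B)
  (tau : {RV Pr >-> seqspace R})
  (tau_law : iid Pr (fun n w => tau w n) (uniform_prob (@ltr01 R)))
  (zeta_tau_indep : independent_pair Pr zeta tau)
  (eps : R) (eps_gt0 : 0 < eps) (eps_lt1 : eps < 1) :
  iid Pr (fun n w => err S A Q eps (zeta w) (tau w) n) (bernoulli_prob eps).
Proof.
rewrite (_ : (fun n w => err S A Q eps (zeta w) (tau w) n) =
             (fun n w => miss S A Q zeta tau eps n w)).
  exact: (miss_iid S_ATTS A Q_rcd P_model zeta_law tau_law zeta_tau_indep).
apply/funext => n; apply/funext => w.
rewrite /err /prediction_region /miss/= -surjective_pairing first_obs_rcons.
by rewrite asboolb -leNgt.
Qed.
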